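(* Let $\mathfrak g$ be an indecomposable and symmetrizable Kac-Moody algebra which is maximally finitely $\Sigma$-graded with indecomposable grading subalgebra $\mathfrak m$; let $\rho:I\to\overline I$ be the quotient map defined by $\rho_a(\alpha_k)=\gamma_{\rho(k)}$, and $\Gamma_s=\rho^{-1}(\{s\})$ for $s\in\overline I$. Then: (1) If $k\ne l\in I$ and $\rho(k)=\rho(l)$, then there is no link between $k$ and $l$ in the Dynkin diagram of $A$: $\alpha_k(\alpha_l^\vee)=\alpha_l(\alpha_k^\vee)=0$ and $(\alpha_k,\alpha_l)=0$. (2) $\mathfrak a\subset\{h\in\mathfrak h\mid\alpha_k(h)=\alpha_l(h)\text{ whenever }\rho(k)=\rho(l)\}$. (3) For good choices of the simple coroots and Chevalley generators $(\alpha_k^\vee,e_k,f_k)_{k\in I}$ in $\mathfrak g$ and $(\gamma_s^\vee,\overline X_s,\overline Y_s)_{s\in\overline I}$ in $\mathfrak m$, one has $\gamma_s^\vee=\sum_{k\in\Gamma_s}\alpha_k^\vee$, $\overline X_s=\sum_{k\in\Gamma_s}e_k$ and $\overline Y_s=\sum_{k\in\Gamma_s}f_k$. (4) In particular, for $s,t\in\overline I$, $\gamma_s(\gamma_t^\vee)=\sum_{k\in\Gamma_t}\alpha_i(\alpha_k^\vee)$ for any $i\in\Gamma_s$.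
   Context: Complex Kac-Moody algebras $\mathfrak g=\mathfrak g(A)$ are associated to generalized Cartan matrices $A=(a_{i,j})_{i,j\in I}$ and (minimal) realizations $(\mathfrak h,\Pi=\{\alpha_i\},\{\alpha_i^\vee\})$, $\dim\mathfrak h=|I|+\mathrm{corank}(A)$, $\langle\alpha_j,\alpha_i^\vee\rangle=a_{i,j}$, with Chevalley generators $e_i,f_i$, $[e_i,f_j]=\delta_{i,j}\alpha_i^\vee$; $\Delta$ is the root system of $(\mathfrak g,\mathfrak h)$. $(\cdot,\cdot)$ is a nondegenerate invariant symmetric bilinear form on $\mathfrak g$ with $(\alpha_i^\vee,\alpha_i^\vee)$ positive rational for all $i$, and also denotes the induced form on $\mathfrak h^*$. Finite gradation: $\mathfrak g$ is finitely $\Sigma$-graded with grading subalgebra $\mathfrak m$ if (i) $\mathfrak m\subset\mathfrak g$ is a subalgebra which is a Kac-Moody algebra whose root system relative to a Cartan subalgebra $\mathfrak a$ of $\mathfrak m$ is $\Sigma$; (ii) $\mathfrak g=\sum_{\gamma\in\Sigma\cup\{0\}}V_\gamma$, $V_\gamma=\{x\in\mathfrak g:[a,x]=\langle\gamma,a\rangle x\ \forall a\in\mathfrak a\}$; (iii) every $V_\gamma$ ($\gamma\in\Sigma\cup\{0\}$) is finite dimensional. One assumes $\mathfrak a\subset\mathfrak h$; $\rho_a(\alpha)$ is the restriction of $\alpha\in\Delta$ to $\mathfrak a$. One fixes a root basis $\Pi_a=\{\gamma_s\mid s\in\overline I\}$ of $\Sigma$ adapted to $\Pi$, i.e. with $\rho_a(\Delta^+)\subset\Sigma^+\cup\{0\}$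 (the bases can always be so chosen). Set $J=\{j\in I:\rho_a(\alpha_j)=0\}$ and $I'_{im}=\{i\in I:\rho_a(\alpha_i)\notin\Pi_a\cup\{0\}\}$. $\mathfrak g$ is maximally finitely $\Sigma$-graded if $J=I'_{im}=\emptyset$; then each $\rho_a(\alpha_k)$, $k\in I$, is a simple root $\gamma_{\rho(k)}\in\Pi_a$ and $\rho:I\to\overline I$ is surjective. $\gamma_s^\vee$, $\overline X_s$, $\overline Y_s$ denote simple coroots and Chevalley generators of $\mathfrak m$ (relative to $\mathfrak a$, $\Pi_a$), with $(\overline X_s,\gamma_s^\vee,\overline Y_s)$ an $\mathfrak{sl}_2$-triple. *)

(* Defs.v *)
From HB Require Import structures.
From mathcomp Require Import all_boot all_order all_algebra sesquilinear.
From mathcomp Require Import all_classical reals.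
From mathcomp Require Import complex.

Set Implicit Arguments.
Unset Strict Implicit.
Unset Printing Implicit Defensive.

Import Order.TTheory GRing.Theory Num.Theory.
Local Open Scope classical_set_scope.
Local Open Scope ring_scope.

HB.mixin Record isLieAlgebra (K : fieldType) L of GRing.Lmodule K L := {
  bracket : L -> L -> L;
  bracket_bilinear : bilinear_for *:%R *:%R bracket;
  bracketxx : forall x, bracket x x = 0;
  jacobi : forall x y z,
    bracket x (bracket y z) + bracket y (bracket z x)
    + bracket z (bracket x y) = 0
}.

#[short(type="lieAlgType")]
HB.structure Definition LieAlgebra (K : fieldType) :=
  { L of GRing.Lmodule K L & isLieAlgebra K L }.

Definition lie_morphism (K : fieldType) (L1 L2 : lieAlgType K)
    (phi : L1 -> L2) : Prop :=
  forall x y, phi (bracket x y) = bracket (phi x) (phi y).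

Definition lie_subalgebra (K : fieldType) (L : lieAlgType K)
    (S : set L) : Prop :=
  [/\ S 0,
      forall (c : K) x y, S x -> S y -> S (c *: x + y) &
      forall x y, S x -> S y -> S (bracket x y)].

Definition generalized_cartan n (A : 'M[int]_n) : Prop :=
  [/\ forall i, A i i = 2,
      forall i j, i != j -> A i j <= 0 &
      forall i j, A i j = 0 -> A j i = 0].

Definition indecomposable n (A : 'M[int]_n) : Prop :=
  forall S : {set 'I_n}, S != finset.set0 -> S != finset.setTfor 'I_n ->
    exists i j, [/\ i \in S, j \notin S & A i j != 0].

Definition symmetrizable (K : fieldType) n (A : 'M[int]_n) : Prop :=
  exists2 d : 'rV[K]_n, (forall i, d 0 i != 0) &
    (diag_mx d *m map_mx intr A)^T = diag_mx d *m map_mx intr A.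

Definition dynkin_link n (A : 'M[int]_n) (k l : 'I_n) : Prop :=
  k != l /\ (A k l != 0 \/ A l k != 0).

(* Linear forms on a vector space [h] are elements of ['Hom(h, K^o)]. *)
Record is_realization (K : fieldType) n (A : 'M[int]_n) (h : vectType K)
    (alpha : 'I_n -> 'Hom(h, K^o)) (alphav : 'I_n -> h) : Prop := {
  simple_roots_free : free [seq alpha i | i : 'I_n];
  simple_coroots_free : free [seq alphav i | i : 'I_n];
  realization_pairing : forall i j, alpha j (alphav i) = (A i j)%:~R;
  realization_dim :
    \dim {: h} = (n + (n - \rank (map_mx intr A : 'M[K]_n)))%N
}.

(* The Cartan subalgebra is a finite-dimensional space [h] together with a
   linear map [iota] into the Lie algebra (injective in a Kac-Moody algebra). *)
Record kac_moody_relations (K : fieldType) n (A : 'M[int]_n)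
    (h : vectType K) (alpha : 'I_n -> 'Hom(h, K^o)) (alphav : 'I_n -> h)
    (L : lieAlgType K) (iota : h -> L) (e f : 'I_n -> L) : Prop := {
  rel_hh : forall x y, bracket (iota x) (iota y) = 0;
  rel_he : forall x i, bracket (iota x) (e i) = (alpha i x : K) *: e i;
  rel_hf : forall x i, bracket (iota x) (f i) = - (alpha i x : K) *: f i;
  rel_ef : forall i j,
    bracket (e i) (f j) = if i == j then iota (alphav i) else 0;
  rel_serre_e : forall i j, i != j ->
    iter `|1 - A i j|%N (bracket (e i)) (e j) = 0;
  rel_serre_f : forall i j, i != j ->
    iter `|1 - A i j|%N (bracket (f i)) (f j) = 0
}.

(* [g] is the Lie algebra g(A) presented by the generators [h], [e_i], [f_i]
   and the relations above. *)
Record is_kac_moody (K : fieldType) n (A : 'M[int]_n) (g : lieAlgType K)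
    (h : vectType K) (iota : {linear h -> g})
    (alpha : 'I_n -> 'Hom(h, K^o)) (alphav : 'I_n -> h)
    (e f : 'I_n -> g) : Prop := {
  km_cartan_matrix : generalized_cartan A;
  km_realization : is_realization A alpha alphav;
  km_cartan_inj : injective iota;
  km_relations : kac_moody_relations A alpha alphav iota e f;
  km_generated : forall S : set g, lie_subalgebra S ->
    range iota `<=` S -> range e `<=` S -> range f `<=` S -> S = setT;
  km_universal : forall (L : lieAlgType K) (phi : {linear h -> L})
      (E F : 'I_n -> L),
    kac_moody_relations A alpha alphav phi E F ->
    exists psi : {linear g -> L},
      [/\ lie_morphism psi,
          forall x, psi (iota x) = phi x,
          forall i, psi (e i) = E i &
          forall i, psi (f i) = F i]
}.

Definition weight_space (K : fieldType) (L : lieAlgType K) (h : vectType K)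
    (iota : h -> L) (lam : 'Hom(h, K^o)) : set L :=
  [set x | forall t, bracket (iota t) x = (lam t : K) *: x].

Definition root_system (K : fieldType) (L : lieAlgType K) (h : vectType K)
    (iota : h -> L) : set 'Hom(h, K^o) :=
  [set lam | lam != 0 /\ exists2 x, weight_space iota lam x & x != 0].

Definition positive_roots (K : fieldType) (h : vectType K) n
    (Delta : set 'Hom(h, K^o)) (alpha : 'I_n -> 'Hom(h, K^o)) :
    set 'Hom(h, K^o) :=
  Delta `&` [set lam | exists c : 'I_n -> nat, lam = \sum_i alpha i *+ c i].

Record is_standard_form (K : fieldType) n (g : lieAlgType K)
    (h : vectType K) (iota : h -> g) (alphav : 'I_n -> h)
    (form : {biscalar g}) : Prop := {
  form_sym : forall x y, form x y = form y x;
  form_invariant : forall x y z, form (bracket x y) z = form x (bracket y z);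
  form_nondegenerate : forall x, (forall y, form x y = 0) -> x = 0;
  form_coroot_pos : forall i, exists2 q : rat, 0 < q &
    form (iota (alphav i)) (iota (alphav i)) = ratr q
}.

(* The map nu : h -> h^* defined by the restriction of the form to [h], and the
   form induced on h^*.  For a standard form on a Kac-Moody algebra nu is
   bijective, so that [nuV] below is its two-sided inverse. *)
Definition form_nu (K : fieldType) (g : lieAlgType K) (h : vectType K)
    (iota : h -> g) (form : {biscalar g}) : 'Hom(h, 'Hom(h, K^o)) :=
  linfun (fun x : h => linfun (fun y : h => form (iota x) (iota y) : K^o)).

Definition dual_form (K : fieldType) (g : lieAlgType K) (h : vectType K)
    (iota : h -> g) (form : {biscalar g}) (lam mu : 'Hom(h, K^o)) : K :=
  let nuV := (form_nu iota form)^-1%VF in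
  form (iota (nuV lam)) (iota (nuV mu)).

Definition finite_dimensional (K : fieldType) (V : lmodType K)
    (S : set V) : Prop :=
  exists d (b : 'I_d -> V), forall x, S x ->
    exists c : 'I_d -> K, x = \sum_i c i *: b i.

(* The subalgebra is given by the injective Lie morphism [j : m -> g], and its
   Cartan subalgebra by [iotam : a -> m].  The data [B], [gamma], [gammav],
   [X], [Y] are the Cartan matrix, root basis, simple coroots and Chevalley
   generators of [m]. *)
Record finitely_graded (K : fieldType) (g m : lieAlgType K)
    (j : {linear m -> g}) (a : vectType K) (iotam : {linear a -> m}) l
    (B : 'M[int]_l) (gamma : 'I_l -> 'Hom(a, K^o)) (gammav : 'I_l -> a)
    (X Y : 'I_l -> m) (Sigma : set 'Hom(a, K^o)) : Prop := {
  grading_sub_inj : injective j;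
  grading_sub_morphism : lie_morphism j;
  grading_sub_kac_moody : is_kac_moody B iotam gamma gammav X Y;
  grading_roots : root_system iotam = Sigma;
  grading_sum : forall x : g,
    exists (s : seq 'Hom(a, K^o)) (v : 'Hom(a, K^o) -> g),
      (forall lam, lam \in s ->
         (Sigma `|` [set 0]) lam /\ weight_space (j \o iotam) lam (v lam))
      /\ x = \sum_(lam <- s) v lam;
  grading_finite : forall lam, (Sigma `|` [set 0]) lam ->
    finite_dimensional (weight_space (j \o iotam) lam)
}.

(* With [inc : a -> h] the inclusion of Cartan subalgebras, this is the
   restriction map rho_a. *)
Definition restr (K : fieldType) (h a : vectType K) (inc : 'Hom(a, h))
    (lam : 'Hom(h, K^o)) : 'Hom(a, K^o) := (lam \o inc)%VF.

Definition adapted_bases (K : fieldType) (h a : vectType K)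
    (inc : 'Hom(a, h)) n l
    (Delta : set 'Hom(h, K^o)) (alpha : 'I_n -> 'Hom(h, K^o))
    (Sigma : set 'Hom(a, K^o)) (gamma : 'I_l -> 'Hom(a, K^o)) : Prop :=
  restr inc @` positive_roots Delta alpha
    `<=` positive_roots Sigma gamma `|` [set 0].

Definition grading_J (K : fieldType) (h a : vectType K) (inc : 'Hom(a, h)) n
    (alpha : 'I_n -> 'Hom(h, K^o)) : set 'I_n :=
  [set i | restr inc (alpha i) = 0].

Definition grading_Iim (K : fieldType) (h a : vectType K)
    (inc : 'Hom(a, h)) n l (alpha : 'I_n -> 'Hom(h, K^o))
    (gamma : 'I_l -> 'Hom(a, K^o)) : set 'I_n :=
  [set i | ~ (range gamma `|` [set 0]) (restr inc (alpha i))].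

Definition maximally_graded (K : fieldType) (h a : vectType K)
    (inc : 'Hom(a, h)) n l (alpha : 'I_n -> 'Hom(h, K^o))
    (gamma : 'I_l -> 'Hom(a, K^o)) : Prop :=
  grading_J inc alpha = set0 /\ grading_Iim inc alpha gamma = set0.

Definition fibre n l (rho : 'I_n -> 'I_l) (s : 'I_l) : {set 'I_n} :=
  finset (fun k => rho k == s).

(* Main.v *)
Require Import Defs.
From HB Require Import structures.
From mathcomp Require Import all_boot all_order all_algebra sesquilinear.
From mathcomp Require Import all_classical reals.
From mathcomp Require Import complex.

(* By the triangular decomposition of g and freeness of the gamma_s, the degree
   gamma_s part of g is spanned by the e_k, k in Gamma_s.  If k <> l in Gamma_s
   were linked, [e_k, e_l] would be a nonzero element of degree 2 gamma_s, which
   is not a root of m.  Hence X_s = sum x_k e_k and Y_s = sum y_k f_k over Gamma_s,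
   and gamma_s^v = [X_s, Y_s] = sum x_k y_k alpha_k^v; applying alpha_k yields
   x_k y_k = 1, so rescaling e_k by x_k and f_k by y_k keeps the coroots and gives
   the required Chevalley generators. *)

Set Implicit Arguments.
Unset Strict Implicit.
Unset Printing Implicit Defensive.

Import Order.TTheory GRing.Theory Num.Theory.
Local Open Scope classical_set_scope.
Local Open Scope ring_scope.

(** * Lie algebra generalities: generation and weight vectors *)

HB.instance Definition _ (K : fieldType) (L : lieAlgType K) :=
  bilinear_isBilinear.Build K L L L _ _ (@bracket K L) bracket_bilinear.

Section LieAlgebraTheory.
Variables (K : fieldType) (L : lieAlgType K).
Implicit Types x y z : L.

Lemma bracketC x y : bracket x y = - bracket y x.
Proof.
apply/eqP; rewrite -addr_eq0; apply/eqP.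
have := bracketxx (x + y); rewrite linearDl !linearDr /= !bracketxx.
by rewrite add0r addr0.
Qed.

Lemma bracket_derivation x y z :
  bracket x (bracket y z) = bracket (bracket x y) z + bracket y (bracket x z).
Proof.
have := jacobi x y z.
rewrite [bracket z (bracket x y)]bracketC [bracket z x]bracketC linearNr.
by move=> /eqP; rewrite subr_eq0 subr_eq => /eqP.
Qed.

(** By Jacobi, the elements whose bracket maps [S] into itself form a subalgebra; it contains [D],
    hence is everything, so [S] is an ideal containing [D]. *)
Lemma lie_generated_ind (D S : set L) :
  (forall T : set L, lie_subalgebra T -> D `<=` T -> T = setT) ->
  S 0 -> (forall (c : K) x y, S x -> S y -> S (c *: x + y)) ->
  D `<=` S -> (forall d x, D d -> S x -> S (bracket d x)) ->
  S = setT.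
Proof.
move=> Dgen S0 SP DS DadS.
pose N : set L := [set z | forall x, S x -> S (bracket z x)].
have NT : N = setT.
  apply: Dgen => [|d Dd x]; last exact: DadS.
  split=> [x _|c y z Ny Nz x Sx|y z Ny Nz x Sx].
  - by rewrite linear0l.
  - by rewrite linearPl; apply: SP; [apply: Ny|apply: Nz].
  - rewrite -[bracket (bracket y z) x](addrK (bracket z (bracket y x))).
    rewrite -bracket_derivation addrC -scaleN1r.
    by apply: (SP _ _ _ (Nz _ (Ny _ Sx)) (Ny _ (Nz _ Sx))).
apply: Dgen => //; split=> // x y _ Sy.
have Nx : N x by rewrite NT.
exact: Nx.
Qed.

(** This is the independence of weight vectors of distinct weights: [x] minus its [mu]-summands has
    weight [mu], yet is a sum of vectors of other weights. Indexing by an arbitrary [T] lets several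
    summands share a weight. *)
Lemma weight_component (a : vectType K) (io : a -> L) (T : Type)
    (mu : 'Hom(a, K^o)) (wt : T -> 'Hom(a, K^o)) (v : T -> L) (s : seq T) x :
  (forall q, weight_space io (wt q) (v q)) ->
  weight_space io mu x -> x = \sum_(q <- s) v q ->
  x = \sum_(q <- s | wt q == mu) v q.
Proof.
(* Applying [bracket (io t)] minus the scalar [wt q t] kills the head summand, rescales the others,
   and multiplies [y] by [mu t - wt q t], which is nonzero for a suitable [t]; hence the induction
   over all [y] and [u]. *)
have indep (r : seq T) : forall y (u : T -> L), weight_space io mu y ->
    (forall q, weight_space io (wt q) (u q)) ->
    y = \sum_(q <- r | wt q != mu) u q -> y = 0.
  elim: r => [|q r IH] y u wy wu; first by rewrite big_nil.
  rewrite big_cons; case: ifPn => [qmu yE|_ yE]; last exact: IH yE.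
  have [t tP] : exists t, (mu t : K) - wt q t != 0.
    apply: contrapT => nt; case/eqP: qmu; apply/lfunP => t.
    by apply/esym/eqP; rewrite -subr_eq0; apply/negPn/negP => ?; apply: nt; exists t.
  apply/eqP; move: tP; apply: contraTT => y0; apply/negP => tP.
  case/negP: y0; suff /eqP : ((mu t : K) - wt q t) *: y = 0.
    by rewrite scaler_eq0 (negPf tP).
  apply: (IH _ (fun q' => ((wt q' t : K) - wt q t) *: u q')).
  - by move=> t'; rewrite linearZr /= wy !scalerA mulrC.
  - by move=> q' t'; rewrite linearZr /= wu !scalerA mulrC.
  rewrite scalerBl -wy {1}yE linearDr /= wu linear_sumr /=.
  rewrite [in X in _ - X]yE scalerDr opprD addrACA subrr add0r scaler_sumr -sumrB.
  by apply: eq_bigr => q' _; rewrite wu scalerBl.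
move=> wv wx xE; apply/eqP; rewrite -subr_eq0; apply/eqP.
apply: (indep s _ v) => // [t|].
  rewrite linearBr /= wx linear_sumr scalerBr scaler_sumr; congr (_ - _).
  by apply: eq_bigr => q /eqP qmu; rewrite /= wv qmu.
by rewrite [X in X - _]xE (bigID (fun q => wt q == mu)) /= addrAC subrr add0r.
Qed.

End LieAlgebraTheory.

(** * Triangular decomposition and monomial weights *)

Section TriangularDecomposition.
Variables (K : numFieldType) (n : nat) (A : 'M[int]_n) (L : lieAlgType K).
Variables (h : vectType K) (iota : {linear h -> L}).
Variables (alpha : 'I_n -> 'Hom(h, K^o)) (alphav : 'I_n -> h).
Variables (e f : 'I_n -> L).
Hypothesis km : is_kac_moody A iota alpha alphav e f.

Let rel := km_relations km.

Definition chevalley (b : bool) : 'I_n -> L := if b then f else e.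

Definition lie_monomial (E : 'I_n -> L) (i : 'I_n) (w : seq 'I_n) : L :=
  foldr (fun k => bracket (E k)) (E i) w.

(* The sign [b] selects [e] or [f], and the word [i :: w] the iterated bracket;
   words are thereby nonempty. *)
Definition monomial (q : bool * ('I_n * seq 'I_n)) : L :=
  lie_monomial (chevalley q.1) q.2.1 q.2.2.

(** Weights are taken along a map into [h], so that the same monomials serve for [a] and, with the
    identity map, for [h] itself. *)
Definition monomial_weight (a : vectType K) (inc : 'Hom(a, h))
    (q : bool * ('I_n * seq 'I_n)) : 'Hom(a, K^o) :=
  (-1) ^+ q.1 *: \sum_(k <- q.2.1 :: q.2.2) restr inc (alpha k).

Lemma bracket_cartan_chevalley b t i :
  bracket (iota t) (chevalley b i) = ((-1) ^+ b * alpha i t) *: chevalley b i.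
Proof.
case: b; first by rewrite mulN1r (rel_hf rel).
by rewrite mul1r (rel_he rel).
Qed.

Lemma bracket_cartan_monomial b t i w :
  bracket (iota t) (monomial (b, (i, w))) =
  ((-1) ^+ b * \sum_(k <- i :: w) (alpha k t : K)) *: monomial (b, (i, w)).
Proof.
rewrite /monomial; elim: w => [|k w IH] /=.
  by rewrite big_seq1 bracket_cartan_chevalley.
rewrite bracket_derivation bracket_cartan_chevalley IH linearZr linearZl_LR /=.
rewrite -scalerDl -mulrDr; congr (_ * _ *: _).
by rewrite !big_cons addrCA.
Qed.

Lemma monomial_weightP (a : vectType K) (inc : 'Hom(a, h)) q :
  weight_space (iota \o inc) (monomial_weight inc q) (monomial q).
Proof.
case: q => b [i w] t /=; rewrite bracket_cartan_monomial.
congr (_ *: _); rewrite /monomial_weight scale_lfunE sum_lfunE /=.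
congr (_ * _); apply: eq_bigr => k _.
by rewrite /restr comp_lfunE.
Qed.

(** The positive ([b] false) or negative ([b] true) Borel subalgebra, encoded as the span of [h] and
    right-nested brackets. *)
Definition borel (b : bool) : set L := [set x | exists t s,
  x = iota t + \sum_(q <- s) (q.1 : K) *: monomial (b, q.2)].

Lemma borel0 b : borel b 0.
Proof. by exists 0, [::]; rewrite big_nil linear0 addr0. Qed.

Lemma borelP b (c : K) x y : borel b x -> borel b y -> borel b (c *: x + y).
Proof.
move=> [t [s ->]] [t' [s' ->]].
exists (c *: t + t'), ([seq (c * q.1, q.2) | q <- s] ++ s').
rewrite linearP big_cat big_map /= scalerDr addrACA; congr (_ + (_ + _)).
by rewrite scaler_sumr; apply: eq_bigr => q _; rewrite scalerA.
Qed.

Lemma borelZ b (c : K) x : borel b x -> borel b (c *: x).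
Proof. by move=> hx; rewrite -[_ *: _]addr0; apply: borelP => //; apply: borel0. Qed.

Lemma borel_cartan b t : borel b (iota t).
Proof. by exists t, [::]; rewrite big_nil addr0. Qed.

Lemma borel_monomial b q : borel b (monomial (b, q)).
Proof. by exists 0, [:: (1, q)]; rewrite big_seq1 linear0 scale1r add0r. Qed.

Lemma borel_ad b z :
  (forall t, borel b (bracket z (iota t))) ->
  (forall q, borel b (bracket z (monomial (b, q)))) ->
  forall x, borel b x -> borel b (bracket z x).
Proof.
move=> zh zm x [t [s ->]]; rewrite linearDr linear_sumr /= -[bracket _ _]scale1r.
apply: borelP => //; elim: s => [|q s IH]; first by rewrite big_nil; apply: borel0.
by rewrite big_cons linearZr /=; apply: borelP.
Qed.

Lemma borel_ad_cartan b t x : borel b x -> borel b (bracket (iota t) x).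
Proof.
apply: borel_ad => [t'|[i w]]; first by rewrite (rel_hh rel); apply: borel0.
by rewrite bracket_cartan_monomial; apply/borelZ/borel_monomial.
Qed.

Lemma borel_ad_same b i x : borel b x -> borel b (bracket (chevalley b i) x).
Proof.
apply: borel_ad => [t|[k w]].
  rewrite bracketC bracket_cartan_chevalley -scaleNr.
  exact/borelZ/(borel_monomial b (i, [::])).
exact: (borel_monomial b (k, i :: w)).
Qed.

Lemma bracket_chevalley_opp b i k : exists t,
  bracket (chevalley (~~ b) i) (chevalley b k) = iota t.
Proof.
case: b => /=; rewrite ?(rel_ef rel).
  by case: eqP => _; [exists (alphav i)|exists 0; rewrite linear0].
rewrite bracketC (rel_ef rel).
by case: eqP => _; [exists (- alphav k); rewrite linearN|exists 0; rewrite oppr0 linear0].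
Qed.

(** An opposite generator is moved through the word by the derivation rule: meeting a letter, it
    leaves an element of [h], which acts on the rest by a scalar; meeting the innermost letter, it
    ends in [h]. *)
Lemma borel_ad_opp b i q : borel b (bracket (chevalley (~~ b) i) (monomial (b, q))).
Proof.
case: q => k w; rewrite /monomial /=; elim: w => [|l w IH] /=.
  by have [t ->] := bracket_chevalley_opp b i k; apply: borel_cartan.
rewrite bracket_derivation; have [t ->] := bracket_chevalley_opp b i l.
rewrite -[bracket (iota _) _]scale1r; apply: borelP; last exact: borel_ad_same.
exact: (borel_ad_cartan _ (borel_monomial b (k, w))).
Qed.

(** The spanning half of the decomposition: the sum of the two Borel spans is stable under every
    generator, so [lie_generated_ind] applies. *)
Lemma triangular_decomposition x : exists t s,
  x = iota t + \sum_(q <- s) (q.1 : K) *: monomial q.2.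
Proof.
pose S : set L := [set x | exists y z, [/\ borel false y, borel true z & x = y + z]].
have Shalf b y : borel b y -> S y.
  case: b => hy; first by exists 0, y; split; [exact: borel0| |rewrite add0r].
  by exists y, 0; split; [|exact: borel0|rewrite addr0].
have SP (c : K) y z : S y -> S z -> S (c *: y + z).
  move=> [y1 [y2 [? ? ->]]] [z1 [z2 [? ? ->]]].
  exists (c *: y1 + z1), (c *: y2 + z2).
  by split; [exact: borelP|exact: borelP|rewrite scalerDr addrACA].
have ShalfD b c y z : borel b y -> borel c z -> S (y + z).
  by move=> hy hz; rewrite -[y]scale1r; apply: SP; apply: Shalf; eassumption.
have chevD b i y : S y -> S (bracket (chevalley b i) y).
  move=> [y1 [y2 [hy1 hy2 ->]]]; rewrite linearDr /=.
  (* On the opposite Borel the Cartan part moves to the generator's own side, while the monomials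
     stay on theirs. *)
  have opp c z : borel (~~ c) z -> S (bracket (chevalley c i) z).
    move=> [t [s ->]]; rewrite linearDr linear_sumr /=.
    apply: (ShalfD c (~~ c)); first exact/borel_ad_same/borel_cartan.
    elim: s => [|q s IH]; first by rewrite big_nil; apply: borel0.
    rewrite big_cons linearZr /=; apply: borelP => //.
    by have := borel_ad_opp (~~ c) i q.2; rewrite negbK.
  by case: b; rewrite -[X in S (X + _)]scale1r; apply: SP;
    by [apply: opp | apply: Shalf; apply: borel_ad_same].
suff : S = setT.
  move=> ST; have [y [z [[t [s ->]] [t' [s' ->]] ->]]] : S x by rewrite ST.
  exists (t + t'), ([seq (q.1, (false, q.2)) | q <- s] ++
                   [seq (q.1, (true, q.2)) | q <- s']).
  by rewrite big_cat !big_map linearD addrACA.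
apply: (@lie_generated_ind _ _ (range iota `|` range e `|` range f)) => //.
- move=> T Tsub DT; apply: (km_generated km) => // y Dy; apply: DT.
  + by left; left.
  + by left; right.
  + by right.
- exact/(Shalf true)/borel0.
- move=> _ [[[t _ <-]|[i _ <-]]|[i _ <-]].
  + exact/(Shalf true)/borel_cartan.
  + exact/(Shalf false)/(borel_monomial false (i, [::])).
  + exact/(Shalf true)/(borel_monomial true (i, [::])).
- move=> _ y [[[t _ <-]|[i _ <-]]|[i _ <-]] Sy.
  + case: Sy => [y1 [y2 [hy1 hy2 ->]]]; rewrite linearDr /=.
    by apply: (ShalfD false true); apply: borel_ad_cartan.
  + exact: (chevD false).
  + exact: (chevD true).
Qed.

Lemma weight_space_monomials (a : vectType K) (inc : 'Hom(a, h)) mu x :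
  mu != 0 -> weight_space (iota \o inc) mu x -> exists s,
  x = \sum_(q <- s | monomial_weight inc q.2 == mu) (q.1 : K) *: monomial q.2.
Proof.
move=> mu0 wx; have [t [s xE]] := triangular_decomposition x.
(* [None] carries the Cartan summand, of weight 0, so that the whole decomposition is one family of
   weight vectors; [mu != 0] then discards it. *)
pose wt (o : option (K * (bool * ('I_n * seq 'I_n)))) :=
  if o is Some q then monomial_weight inc q.2 else 0.
pose v (o : option (K * (bool * ('I_n * seq 'I_n)))) :=
  if o is Some q then q.1 *: monomial q.2 else iota t.
exists s; rewrite (@weight_component _ _ _ (iota \o inc) _ mu wt v (None :: map some s) x) //.
- by rewrite big_cons /= eq_sym (negPf mu0) big_map.
- case=> [q|] t' /=; last by rewrite (rel_hh rel) zero_lfunE scale0r.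
  by rewrite linearZr /= monomial_weightP !scalerA mulrC.
- by rewrite big_cons big_map.
Qed.

End TriangularDecomposition.

(** Recovers the sign and the word length from a height; the successors match the nonempty words
    [i :: w]. *)
Lemma signed_nat_inj (K : numDomainType) (b c : bool) (k l : nat) :
  (-1) ^+ b * k.+1%:R = (-1) ^+ c * l.+1%:R :> K -> b = c /\ k = l.
Proof.
have pos (u v : nat) : u.+1%:R == - v.+1%:R :> K = false.
  by rewrite -addr_eq0 -natrD pnatr_eq0.
case: b c => [] []; rewrite ?mulN1r ?mul1r => /eqP.
- by rewrite eqr_opp eqr_nat => /eqP [->].
- by rewrite eq_sym pos.
- by rewrite pos.
- by rewrite eqr_nat => /eqP [->].
Qed.

Lemma free_dual (K : fieldType) (V : vectType K) p (v : 'I_p -> V) :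
  free [seq v i | i : 'I_p] ->
  exists c : 'I_p -> {linear V -> K^o}, forall i k, c i (v k) = (k == i)%:R.
Proof.
move=> fv; have XE : tval [tuple v i | i < p] = [seq v i | i : 'I_p].
  by rewrite /= /image_mem; congr map; rewrite enumT; apply: val_ord_tuple.
exists (coord [tuple v i | i < p]) => i k.
have -> : v k = [tuple v i | i < p]`_k by rewrite -tnth_nth tnth_mktuple.
by rewrite /= coord_free ?XE // eq_sym.
Qed.

(** * Heights and the spaces of degree plus or minus a simple root *)

Section SimpleRootSpaces.
Variables (K : numFieldType) (n : nat) (A : 'M[int]_n) (L : lieAlgType K).
Variables (h : vectType K) (iota : {linear h -> L}).
Variables (alpha : 'I_n -> 'Hom(h, K^o)) (alphav : 'I_n -> h).
Variables (e f : 'I_n -> L).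
Hypothesis km : is_kac_moody A iota alpha alphav e f.
Variables (a : vectType K) (inc : 'Hom(a, h)) (p : nat).
Variables (gamma : 'I_p -> 'Hom(a, K^o)) (rho : 'I_n -> 'I_p).
Hypothesis gamma_free : free [seq gamma s | s : 'I_p].
Hypothesis rhoP : forall k, restr inc (alpha k) = gamma (rho k).

(** [H] sums the coordinates along the [gamma s]. Each [alpha k] restricts to one [gamma s], so [H]
    counts the letters of a word, with sign. *)
Lemma height_form : exists H : 'Hom(a, K^o) -> K,
  (forall s, H (gamma s) = 1) /\ (forall (c : K) s, H (c *: gamma s) = c) /\
  forall q, H (monomial_weight alpha inc q) = (-1) ^+ q.1 * (size q.2.2).+1%:R.
Proof.
have [c cE] := free_dual gamma_free.
pose H (x : 'Hom(a, K^o)) : K := \sum_i c i x.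
have HZ (z : K) x : H (z *: x) = z * H x.
  by rewrite mulr_sumr; apply: eq_bigr => i _; rewrite linearZ.
have H1 s : H (gamma s) = 1.
  rewrite /H (bigD1 s) //= cE eqxx big1 ?addr0 // => i /negPf.
  by rewrite cE eq_sym => ->.
exists H; split=> //; split=> [z s|[b [i w]] /=]; first by rewrite HZ H1 mulr1.
rewrite HZ; congr (_ * _).
rewrite -[(size w).+1]/(size (i :: w)); elim: (i :: w) => [|k r IH].
  by rewrite /H big1 // => k _; rewrite big_nil linear0.
rewrite big_cons rhoP /= -natr1 addrC -IH -(H1 (rho k)) /H -big_split /=.
by apply: eq_bigr => l _; rewrite linearD.
Qed.

Lemma monomial_weight_neq0 q : monomial_weight alpha inc q != 0.
Proof.
have [H [_ [HZ HE]]] := height_form.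
(* Zero is written as a multiple of a simple root, where [H] is known. *)
apply/eqP => q0; have := HE q; rewrite q0 -(scale0r (gamma (rho q.2.1))) HZ.
by move/esym/eqP; rewrite mulf_eq0 signr_eq0 pnatr_eq0.
Qed.

Lemma simple_root_neq0 (c : K) s : c != 0 -> c *: gamma s != 0.
Proof.
have [H [_ [HZ _]]] := height_form.
apply: contra => /eqP c0; have := HZ c s.
by rewrite c0 -(scale0r (gamma s)) HZ => <-.
Qed.

(** A monomial of height plus or minus 1 is a single generator of the matching sign, and freeness of
    [gamma] puts its index in the fibre of [s]. *)
Lemma simple_root_space (b : bool) s x :
  weight_space (iota \o inc) ((-1) ^+ b *: gamma s) x ->
  exists c : 'I_n -> K, x = \sum_(k in fibre rho s) c k *: chevalley e f b k.
Proof.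
move=> wx; have sgn0 : (-1) ^+ b != 0 :> K by rewrite signr_eq0.
have [r ->] := weight_space_monomials km (simple_root_neq0 s sgn0) wx.
pose P y := exists c : 'I_n -> K, y = \sum_(k in fibre rho s) c k *: chevalley e f b k.
apply: (big_ind P).
- by exists (fun=> 0); rewrite big1 // => k _; rewrite scale0r.
- move=> _ _ [c ->] [d ->]; exists (fun k => c k + d k).
  by rewrite -big_split; apply: eq_bigr => k _; rewrite scalerDl.
case=> z [b' [i w]] /= /eqP wE.
have [H [_ [HZ HE]]] := height_form.
have := HE (b', (i, w)); rewrite wE HZ /= -[LHS]mulr1.
case/(@signed_nat_inj K b b' 0) => bb /esym/size0nil w0.
move: wE; rewrite /monomial_weight -bb w0 big_seq1 /= rhoP => /(scalerI sgn0).
have [c cE] := free_dual gamma_free.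
move/(congr1 (c s)); rewrite !cE eqxx.
(* Outside the fibre, the coordinate along [gamma s] would give 0 = 1. *)
case: (rho i =P s) => [si _|_ /eqP]; last by rewrite eqr_nat.
exists (fun k => if k == i then z else 0).
rewrite (bigD1 i) /= ?inE ?si // eqxx big1 ?addr0 // => k /andP [_ /negPf ->].
by rewrite scale0r.
Qed.

End SimpleRootSpaces.

(** * Doubled simple roots, nonzero brackets and rescaled generators *)

Section SimpleRootMultiples.
Variables (K : numFieldType) (n : nat) (A : 'M[int]_n) (L : lieAlgType K).
Variables (h : vectType K) (iota : {linear h -> L}).
Variables (alpha : 'I_n -> 'Hom(h, K^o)) (alphav : 'I_n -> h).
Variables (e f : 'I_n -> L).
Hypothesis km : is_kac_moody A iota alpha alphav e f.

Let alpha_free := simple_roots_free (km_realization km).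

Lemma restr_id lam : restr \1%VF lam = lam :> 'Hom(h, K^o).
Proof. by rewrite /restr comp_lfun1r. Qed.

(** Monomials of height 2 are brackets of two [e]'s; freeness of the simple roots forces both to be
    [e s], and that bracket vanishes. Heights are used with [inc] and [rho] the identities. *)
Lemma double_simple_root s : ~ root_system iota (2 *: alpha s).
Proof.
case=> a0 [x wx]; apply/negP; rewrite negbK.
have wx1 : weight_space (iota \o (\1%VF : 'Hom(h, h))) (2 *: alpha s) x.
  by move=> t; rewrite /= id_lfunE wx.
have [r ->] := weight_space_monomials km a0 wx1.
rewrite big1 // => -[z [b [i w]]] /= /eqP wE.
have rhoP k : restr \1%VF (alpha k) = alpha (id k) by exact: restr_id.
have [H [_ [HZ HE]]] := height_form alpha_free rhoP.
have := HE (b, (i, w)); rewrite wE HZ /= -[LHS]mul1r.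
case/(@signed_nat_inj K false b 1) => b0 w1.
case: w w1 wE => [|k [|//]] // _; rewrite -b0.
rewrite /monomial_weight big_cons big_seq1 /= !rhoP scale1r.
have [c cE] := free_dual alpha_free.
move/(congr1 (c s)); rewrite linearD linearZ /= !cE eqxx.
rewrite -natrD [_ *: _]mulr1 => /eqP; rewrite eqr_nat.
case: (i =P s) => [->|_]; case: (k =P s) => [->|_] // _.
by rewrite /monomial /= bracketxx scaler0.
Qed.

Lemma coroot_neq0 i : alphav i != 0.
Proof.
apply/eqP => a0; have := realization_pairing (km_realization km) i i.
case: (km_cartan_matrix km) => -> _ _.
by rewrite a0 linear0 => /eqP; rewrite eq_sym pnatr_eq0.
Qed.

Lemma chevalley_e_neq0 i : e i != 0.
Proof.
apply/eqP => e0; have := rel_ef (km_relations km) i i.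
rewrite e0 linear0l eqxx => /esym; rewrite -(linear0 iota).
by move/(km_cartan_inj km)/eqP; apply/negP; exact: coroot_neq0.
Qed.

(** Bracketing with [f k] turns the bracket into [- A k l] times [e l], because [f k] commutes with
    [e l]. *)
Lemma bracket_e_neq0 k l : k != l -> A k l != 0 -> bracket (e k) (e l) != 0.
Proof.
move=> kl; apply: contra => /eqP kl0.
have := bracket_derivation (f k) (e k) (e l).
rewrite kl0 linear0r [bracket (f k) (e l)]bracketC (rel_ef (km_relations km)).
rewrite eq_sym (negPf kl) oppr0 linear0r addr0 bracketC.
rewrite [bracket (f k) _]bracketC (rel_ef (km_relations km)) eqxx linearNr /= opprK.
rewrite bracketC (rel_he (km_relations km)) => /esym/eqP; rewrite oppr_eq0 scaler_eq0.
rewrite (negPf (chevalley_e_neq0 l)) orbF.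
by rewrite (realization_pairing (km_realization km)) intr_eq0.
Qed.

(** The relations are homogeneous in each generator, and [x k * y k = 1] preserves the coroot
    relation. *)
Lemma rescale_chevalley (x y : 'I_n -> K) : (forall k, x k * y k = 1) ->
  is_kac_moody A iota alpha alphav (fun k => x k *: e k) (fun k => y k *: f k).
Proof.
move=> xy.
have iterZ (L' : lieAlgType K) (c d : K) (u v : L') N :
    iter N (bracket (c *: u)) (d *: v) = (c ^+ N * d) *: iter N (bracket u) v.
  elim: N => [|N IH] /=; first by rewrite mul1r.
  by rewrite IH linearZl_LR linearZr /= scalerA exprS mulrA.
have relZ (L' : lieAlgType K) (phi : {linear h -> L'}) (E F : 'I_n -> L')
    (c d : 'I_n -> K) : (forall k, c k * d k = 1) ->
    kac_moody_relations A alpha alphav phi E F ->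
    kac_moody_relations A alpha alphav phi
      (fun k => c k *: E k) (fun k => d k *: F k).
  move=> cd [hh he hf ef se sf]; split=> //.
  - by move=> t i; rewrite linearZr /= he !scalerA mulrC.
  - by move=> t i; rewrite linearZr /= hf !scalerA mulrC.
  - move=> i k; rewrite linearZl_LR linearZr /= ef scalerA.
    by case: eqP => [->|_]; rewrite ?cd ?scale1r ?scaler0.
  - by move=> i k ik; rewrite iterZ se // scaler0.
  - by move=> i k ik; rewrite iterZ sf // scaler0.
have yx k : y k * x k = 1 by rewrite mulrC.
case: (km) => cm re inj r gen univ; split=> //; first exact: relZ.
- move=> S [S0 SP Sb] hS eS fS; apply: gen => //.
  + move=> _ [i _ <-]; rewrite -[e i]scale1r -(yx i) -scalerA -[_ *: _]addr0.
    by apply: SP => //; apply: eS; exists i.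
  + move=> _ [i _ <-]; rewrite -[f i]scale1r -(xy i) -scalerA -[_ *: _]addr0.
    by apply: SP => //; apply: fS; exists i.
(* Universality is applied to the inversely rescaled targets [y k *: E k] and [x k *: F k]. *)
- move=> L' phi E F /(relZ _ _ _ _ _ _ yx)/univ [psi [morph pi pe pf]].
  exists psi; split=> // i; rewrite linearZ /=.
    by rewrite pe scalerA xy scale1r.
  by rewrite pf scalerA yx scale1r.
Qed.

End SimpleRootMultiples.

(** Serves to evaluate [form_nu], which applies [linfun] to unbundled functions. *)
Lemma linfun_linearE (K : fieldType) (V W : vectType K) (u : V -> W) :
  linear u -> linfun u =1 u.
Proof.
move=> lu x.
pose u' : {linear V -> W} := HB.pack u (GRing.isLinear.Build K V W *:%R u lu).
exact: (lfunE u').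
Qed.

(** * The invariant form on [h] and its dual *)

Section StandardForm.
Variables (K : numFieldType) (n : nat) (A : 'M[int]_n) (g : lieAlgType K).
Variables (h : vectType K) (iota : {linear h -> g}).
Variables (alpha : 'I_n -> 'Hom(h, K^o)) (alphav : 'I_n -> h).
Variables (e f : 'I_n -> g) (form : {biscalar g}).
Hypothesis km : is_kac_moody A iota alpha alphav e f.
Hypothesis std : is_standard_form iota alphav form.

Let alpha_free := simple_roots_free (km_realization km).
Let rhoP k : restr \1%VF (alpha k) = alpha (id k).
Proof. exact: restr_id. Qed.

(** By invariance, 0 = ([t,u], x) = (t, [u,x]) = lam(u) (t, x), with [u] chosen so that [lam u] is
    nonzero. *)
Lemma form_weight_orthogonal t lam x :
  weight_space iota lam x -> lam != 0 -> form (iota t) x = 0.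
Proof.
move=> wx l0; have [u uP] : exists u, (lam u : K) != 0.
  apply: contrapT => nu; case/eqP: l0; apply/lfunP => u; rewrite zero_lfunE.
  by apply/eqP/negPn/negP => ?; apply: nu; exists u.
have := form_invariant std (iota t) (iota u) x.
rewrite (rel_hh (km_relations km)) wx linear0l linearZr /= => /esym/eqP.
by rewrite mulf_eq0 (negPf uP) => /eqP.
Qed.

(** All monomials have nonzero weight, hence are orthogonal to [h]; the radical on [h] lies in the
    radical on [g]. *)
Lemma form_cartan_nondegenerate t :
  (forall u, form (iota t) (iota u) = 0) -> t = 0.
Proof.
move=> tu; apply: (km_cartan_inj km); rewrite linear0.
apply: (form_nondegenerate std) => y.
have [u [s ->]] := triangular_decomposition km y.
rewrite linearDr linear_sumr /= tu add0r big1 // => q _.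
rewrite linearZr /= (@form_weight_orthogonal _ (monomial_weight alpha \1%VF q.2)).
- by rewrite mulr0.
- by move=> v; have := monomial_weightP km \1%VF q.2 v; rewrite /= id_lfunE.
- exact: monomial_weight_neq0 alpha_free rhoP _.
Qed.

Lemma form_nuE t u : form_nu iota form t u = form (iota t) (iota u) :> K.
Proof.
have inner v : linear (fun w : h => form (iota v) (iota w) : K^o).
  by move=> c x y; rewrite linearP linearDr linearZr.
rewrite /form_nu linfun_linearE ?linfun_linearE // => c x y.
apply/lfunP => w; rewrite add_lfunE scale_lfunE !linfun_linearE //.
by rewrite linearP linearDl linearZl_LR.
Qed.

(** Write the coroot as [e_k, f_k] and move [e k] across by invariance. *)
Lemma form_nu_coroot k : form_nu iota form (alphav k) = form (e k) (f k) *: alpha k.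
Proof.
apply/lfunP => u; rewrite form_nuE scale_lfunE.
have := rel_ef (km_relations km) k k; rewrite eqxx => <-.
rewrite (form_invariant std) bracketC (rel_hf (km_relations km)).
by rewrite scaleNr opprK linearZr /= mulrC.
Qed.

(** Otherwise [form_nu] would kill the coroot, against its positive square length. *)
Lemma form_ef_neq0 k : form (e k) (f k) != 0.
Proof.
have [q q0 qE] := form_coroot_pos std k.
apply: contraTneq q0 => ef0; rewrite -(ltr0q K) -qE -form_nuE form_nu_coroot ef0.
by rewrite scale0r zero_lfunE ltxx.
Qed.

(** The inverse of [form_nu] sends each simple root to a multiple of its coroot, so the dual form is
    a multiple of [alpha k (alphav l)]. *)
Lemma dual_form_simple_roots k l :
  alpha k (alphav l) = 0 -> dual_form iota form (alpha k) (alpha l) = 0.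
Proof.
move=> kl.
have nuI : lker (form_nu iota form) == 0%VS.
  apply/lker0P => x y xy; apply/eqP; rewrite -subr_eq0; apply/eqP.
  apply: form_cartan_nondegenerate => u; rewrite linearB linearBl /= -!form_nuE xy.
  exact: subrr.
have inv i : ((form_nu iota form)^-1%VF (alpha i)) = (form (e i) (f i))^-1 *: alphav i.
  rewrite -[RHS](lker0_lfunK nuI) linearZ /= form_nu_coroot scalerA.
  by rewrite mulVf ?scale1r // form_ef_neq0.
have iZ c x : iota (c *: x) = c *: iota x by exact: linearZ.
rewrite /dual_form !inv !iZ linearZl_LR linearZr /= -form_nuE form_nu_coroot.
by rewrite scale_lfunE kl scaler0 !mulr0.
Qed.

End StandardForm.

Theorem proposition4p1 (R : realType)
  (n : nat) (A : 'M[int]_n) (g : lieAlgType R[i]) (h : vectType R[i])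
  (iota : {linear h -> g}) (alpha : 'I_n -> 'Hom(h, R[i]^o))
  (alphav : 'I_n -> h) (e f : 'I_n -> g) (form : {biscalar g})
  (p : nat) (B : 'M[int]_p) (m : lieAlgType R[i]) (j : {linear m -> g})
  (a : vectType R[i]) (iotam : {linear a -> m})
  (gamma : 'I_p -> 'Hom(a, R[i]^o)) (gammav : 'I_p -> a) (X Y : 'I_p -> m)
  (Sigma : set 'Hom(a, R[i]^o)) (inc : 'Hom(a, h)) (rho : 'I_n -> 'I_p)
  (hg : is_kac_moody A iota alpha alphav e f)
  (hA : indecomposable A)
  (hsym : symmetrizable R[i] A)
  (hform : is_standard_form iota alphav form)
  (hgrad : finitely_graded j iotam B gamma gammav X Y Sigma)
  (hB : indecomposable B)
  (hinc : forall t, iota (inc t) = j (iotam t))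
  (hadapted : adapted_bases inc (root_system iota) alpha Sigma gamma)
  (hmax : maximally_graded inc alpha gamma)
  (hrho : forall k, restr inc (alpha k) = gamma (rho k)) :
  [/\ forall k l, k != l -> rho k = rho l ->
        [/\ ~ dynkin_link A k l,
            alpha k (alphav l) = 0, alpha l (alphav k) = 0 &
            dual_form iota form (alpha k) (alpha l) = 0],
      range inc `<=`
        [set x | forall k l, rho k = rho l -> alpha k x = alpha l x],
      exists (alphav' : 'I_n -> h) (e' f' : 'I_n -> g)
             (gammav' : 'I_p -> a) (X' Y' : 'I_p -> m),
        [/\ is_kac_moody A iota alpha alphav' e' f',
            is_kac_moody B iotam gamma gammav' X' Y' &
            forall s,
              [/\ inc (gammav' s) = \sum_(k in fibre rho s) alphav' k,
                  j (X' s) = \sum_(k in fibre rho s) e' k &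
                  j (Y' s) = \sum_(k in fibre rho s) f' k]] &
      forall (s t : 'I_p) (i : 'I_n), i \in fibre rho s ->
        gamma s (gammav t) = \sum_(k in fibre rho t) alpha i (alphav k)].
Proof.
have jm := grading_sub_kac_moody hgrad.
have gamma_free := simple_roots_free (km_realization jm).
have jrel := km_relations jm.
have jbr := grading_sub_morphism hgrad.
have ev k t : alpha k (inc t) = gamma (rho k) t by rewrite -hrho comp_lfunE.
(* A link would put the nonzero [e_k, e_l] in degree [2 gamma_s], not a root of [m]. *)
have unlinked k l : k != l -> rho k = rho l -> A k l = 0.
  move=> kl rkl; apply/eqP; apply: contraT => /(bracket_e_neq0 hg kl) ne0.
  have w2 : weight_space (j \o iotam) (2 *: gamma (rho k)) (bracket (e k) (e l)).
    move=> t; rewrite /= -hinc bracket_derivation !(rel_he (km_relations hg)).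
    rewrite linearZl_LR linearZr /= -scalerDl; congr (_ *: _).
    by rewrite !ev -rkl scale_lfunE [_ *: _]mulr_natl.
  case/eqP: ne0; have [s [v [vP xE]]] := grading_sum hgrad (bracket (e k) (e l)).
  (* Extending [v] by 0 outside [s] makes every value a weight vector, as [weight_component]
     requires. *)
  pose v' lam := if lam \in s then v lam else 0.
  rewrite (@weight_component _ _ _ _ _ _ id v' s _ _ w2).
  (* No summand has degree [2 *: gamma (rho k)], which is neither a root of [m] nor 0, so the
     projection is an empty sum. *)
  - rewrite big_seq_cond big_pred0 // => lam; apply/negP => /andP [ls /eqP lam2].
    have [[]] := vP lam ls; rewrite lam2 -?(grading_roots hgrad).
      by move/(double_simple_root jm).
    move=> g0 _; have : (2 : R[i]) != 0 by rewrite pnatr_eq0.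
    by move/(simple_root_neq0 gamma_free hrho (rho k))/eqP; apply.
  - move=> lam; rewrite /v'; case: ifP => [/vP [] //|_] t.
    by rewrite linear0r scaler0.
  - by rewrite xE; apply: eq_big_seq => lam ls; rewrite /v' ls.
have orth k l : k != l -> rho k = rho l -> alpha k (alphav l) = 0.
  move=> kl rkl; rewrite (realization_pairing (km_realization hg)).
  by rewrite unlinked // eq_sym.
have expand (b : bool) (Z : 'I_p -> m) :
    (forall s, weight_space iotam ((-1) ^+ b *: gamma s) (Z s)) ->
    exists c : 'I_n -> R[i], forall s,
      j (Z s) = \sum_(k in fibre rho s) c k *: chevalley e f b k.
  move=> wZ.
  have ex s : exists c : 'I_n -> R[i],
      j (Z s) = \sum_(k in fibre rho s) c k *: chevalley e f b k.
    apply: (simple_root_space hg gamma_free hrho) => t /=.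
    by rewrite hinc -jbr wZ linearZ.
  (* The fibres are disjoint, so the coefficients chosen for each [s] glue to one family indexed by
     [k]. *)
  have [c cE] := choice ex; exists (fun k => c (rho k) k) => s.
  by rewrite cE; apply: eq_bigr => k; rewrite inE => /eqP ->.
have [x xE] : exists x : 'I_n -> R[i], forall s,
    j (X s) = \sum_(k in fibre rho s) x k *: e k.
  by apply: (expand false) => s t; rewrite scale1r (rel_he jrel).
have [y yE] : exists y : 'I_n -> R[i], forall s,
    j (Y s) = \sum_(k in fibre rho s) y k *: f k.
  by apply: (expand true) => s t; rewrite scaleN1r opp_lfunE (rel_hf jrel).
have coroot s : inc (gammav s) = \sum_(k in fibre rho s) (x k * y k) *: alphav k.
  (* Expand [X_s, Y_s] inside [g]: the cross terms [e_k, f_l] with distinct indices vanish. *)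
  apply: (km_cartan_inj hg); rewrite hinc.
  have := rel_ef jrel s s; rewrite eqxx => <-.
  rewrite jbr xE yE linear_sumlz /= linear_sum; apply: eq_bigr => k ks.
  rewrite linear_sumr (bigD1 k) //= big1 ?addr0 => [|l /andP [_ /negPf lk]].
    rewrite linearZl_LR linearZr /= (rel_ef (km_relations hg)) eqxx.
    by rewrite scalerA; apply/esym/linearZ.
  rewrite linearZl_LR linearZr /= (rel_ef (km_relations hg)).
  by rewrite eq_sym lk !scaler0.
(* As the fibre of [rho k] is unlinked, pairing the coroot formula with [alpha k]
   gives [x k * y k * 2 = 2]. *)
have xy k : x k * y k = 1.
  have := ev k (gammav (rho k)).
  rewrite coroot linear_sum (bigD1 k) ?inE //= big1 ?addr0; last first.
    move=> l; rewrite inE => /andP [/eqP rlk lk].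
    by rewrite linearZ /= orth ?scaler0 // eq_sym.
  rewrite linearZ /= (realization_pairing (km_realization hg)).
  rewrite (realization_pairing (km_realization jm)).
  case: (km_cartan_matrix hg) => -> _ _; case: (km_cartan_matrix jm) => -> _ _.
  by rewrite -[RHS]mul1r; apply: mulIf; rewrite pnatr_eq0.
have corootE s : inc (gammav s) = \sum_(k in fibre rho s) alphav k.
  by rewrite coroot; apply: eq_bigr => k _; rewrite xy scale1r.
split.
- move=> k l kl rkl; have lk : l != k by rewrite eq_sym.
  split; [|exact: orth|exact: orth|].
    by case=> _ []; rewrite unlinked ?eqxx.
  exact: (dual_form_simple_roots hg hform (orth _ _ kl rkl)).
- by move=> _ [t _ <-] k l rkl; rewrite !ev rkl.
(* Only the [e k] and [f k] are rescaled; both families of coroots and the generators of [m] are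
   kept. *)
- exists alphav, (fun k => x k *: e k), (fun k => y k *: f k), gammav, X, Y.
  by split=> //; exact: rescale_chevalley.
- move=> s t i; rewrite inE => /eqP <-.
  by rewrite -ev corootE linear_sum.
Qed.
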